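(* If there is an upcycle for $A^n$ with diamondicity $d$ and $a:=|A|$, then $n\mid d\,a^{n-d-1}$. In particular, if $\gcd(d,n)=1$, then $n\mid a^{n-d-1}$.
   Context: Let $A$ be an alphabet with $a=|A|\ge 2$ letters and $\diamond\notin A$ a wildcard symbol (''diamond''). A partial word is a finite sequence over $A\cup\{\diamond\}$; a cyclic partial word $u=(u_1\cdots u_N)$ is cyclically ordered, with indices taken modulo $N$. A partial word $x$ covers a word $y$ of the same length if for each $i$ either $x_i=\diamond$ or $x_i=y_i$. For $n\ge 1$, an upcycle for $A^n$ is a cyclic partial word $u=(u_1\cdots u_N)$ such that for each word $y\in A^n$ there is exactly one position $i\in\{1,\dots,N\}$ such that the window $u_i\cdots u_{i+n-1}$ covers $y$. It is known that the diamonds of an upcycle are $n$-periodic ($u_i=\diamond$ implies $u_{i+n}=\diamond$), so all windows contain the same number $d$ of diamonds, called the diamondicity. *)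

(* Defs.v *)
From mathcomp Require Import all_boot.

Set Implicit Arguments.
Unset Strict Implicit.
Unset Printing Implicit Defensive.

Section Upcycles.

Variable A : finType.

(* [None] is the diamond. *)
Definition partial_word (n : nat) := n.-tuple (option A).

Definition covers (n : nat) (x : partial_word n) (y : n.-tuple A) : bool :=
  [forall i : 'I_n, (tnth x i == None) || (tnth x i == Some (tnth y i))].

(* Positions are numbered from 0 and read modulo N.  The window may be longer
   than the cyclic word (N < n), in which case it wraps around.  The default
   value [None] of [nth] is used only when N = 0. *)
Definition window (N : nat) (u : partial_word N) (n i : nat) : partial_word n :=
  [tuple nth None u ((i + j) %% N) | j < n].

Definition upcycle (n N : nat) (u : partial_word N) : Prop :=
  forall y : n.-tuple A, exists! i : 'I_N, covers (window u n i) y.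

Definition diamonds (n : nat) (x : partial_word n) : nat := count_mem None x.

Definition has_diamondicity (n N : nat) (u : partial_word N) (d : nat) : Prop :=
  forall i : 'I_N, diamonds (window u n i) = d.

(* [has_diamondicity n u d] only names [d]: every upcycle has a
   diamondicity, because its diamonds are n-periodic. *)

Lemma window_covers (n N : nat) (u : partial_word N) (i : nat) (y : n.-tuple A) :
  reflect (forall j : 'I_n, nth None u ((i + j) %% N) = None \/
                            nth None u ((i + j) %% N) = Some (tnth y j))
          (covers (window u n i) y).
Proof.
apply: (iffP forallP) => h j; have := h j; rewrite tnth_mktuple.
  by case/orP => /eqP; [left | right].
by case=> ->; rewrite eqxx ?orbT.
Qed.

Lemma upcycle_periodic (n N : nat) (u : partial_word N) (i : nat) :
  1 < #|A| -> 0 < n -> upcycle n u ->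
  nth None u (i %% N) = None -> nth None u ((i + n) %% N) = None.
Proof.
move=> hA hn hu hi; case hb: (nth None u ((i + n) %% N)) => [b|] //.
have [b' neq_b] : exists b', b' != b.
  have /card_gt0P [b' hb'] : 0 < #|predC1 b| by rewrite cardC1; case: #|A| hA => [|[]].
  by exists b'.
pose c k := nth None u (k %% N); pose f k := odflt b (c k).
have [k [/window_covers hk _]] :=
  hu [tuple if j == n.-1 :> nat then b' else f (i + j.+1) | j < n].
have N_gt0 : 0 < N by apply: leq_ltn_trans (ltn_ord k).
have shift m : c (k + N.-1 + m.+1) = c (k + m).
  have -> : k + N.-1 + m.+1 = N + (k + m).
    by rewrite addnS -addSn -addnS prednK // addnAC addnC.
  by rewrite /c modnDl.
pose y2 := [tuple if j == 0 :> nat then f (k + N.-1) else f (i + j) | j < n].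
have cov1 : covers (window u n ((k + N.-1) %% N)) y2.
  apply/window_covers => -[[|j] hj]; rewrite modnDml tnth_mktuple /=.
    by rewrite addn0 /f /c; case: nth => [x|]; [right | left].
  have hj' : j < n by exact: ltnW.
  have := hk (Ordinal hj'); rewrite tnth_mktuple /= -!/(c _) shift.
  by have /ltn_eqF -> : j < n.-1 by rewrite -ltnS prednK.
have cov2 : covers (window u n (i %% N)) y2.
  apply/window_covers => -[[|j] hj]; rewrite modnDml tnth_mktuple /=.
    by rewrite addn0; left.
  by rewrite /f /c; case: nth => [x|]; [right | left].
have [l [_ uniq_l]] := hu y2.
have e1 := uniq_l (Ordinal (ltn_pmod (k + N.-1) N_gt0)) cov1.
have e2 := uniq_l (Ordinal (ltn_pmod i N_gt0)) cov2.
have /(congr1 val) /= e : Ordinal (ltn_pmod (k + N.-1) N_gt0) = Ordinal (ltn_pmod i N_gt0).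
  by rewrite -e1 -e2.
have hn1 : n.-1 < n by rewrite prednK.
have := hk (Ordinal hn1); rewrite tnth_mktuple /= eqxx -!/(c _) -shift /c.
rewrite prednK // -modnDml e modnDml hb.
by case=> // -[eb]; rewrite eb eqxx in neq_b.
Qed.

Lemma upcycle_has_diamondicity (n N : nat) (u : partial_word N) :
  1 < #|A| -> 0 < n -> upcycle n u -> exists d, has_diamondicity n u d.
Proof.
move=> hA hn hu; pose c k : nat := nth None u (k %% N) == None.
have cE k : diamonds (window u n k) = \sum_(j < n) c (k + j).
  rewrite /diamonds -sum1_count big_tuple big_mkcond /=.
  by apply: eq_bigr => j _; rewrite tnth_mktuple /c /=; case: eqP.
have step k : diamonds (window u n k) <= diamonds (window u n k.+1).
  rewrite !cE; case: (n) hn (upcycle_periodic (i := k) hA hn hu) => // m _ per.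
  rewrite big_ord_recl big_ord_recr /= addn0 addnC leq_add //.
    by apply: eq_leq; apply: eq_bigr => j _; rewrite /bump /= add1n addSnnS.
  rewrite /c addSnnS; case: eqP => // /per ->; by rewrite eqxx.
have mono : {homo (fun k => diamonds (window u n k)) : i j / i <= j}.
  by apply: homo_leq => [//|? ? ?|//]; exact: leq_trans.
exists (diamonds (window u n 0)) => i; apply/eqP.
rewrite eqn_leq (mono 0 i) // andbT.
apply: leq_trans (mono i N (ltnW (ltn_ord i))) _.
by rewrite !cE; apply: eq_leq; apply: eq_bigr => j _; rewrite /c add0n modnDl.
Qed.

End Upcycles.

(* Main.v *)
(** Every window covers [a ^ d] words and every word is covered once, so
    [N * a ^ d = a ^ n].  Let [D] be the number of diamonds in the cyclic word.
    Counting pairs (window, diamond in it) gives [n * D = N * d].  Counting the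
    words that begin with a fixed letter [b], which are covered by the windows
    that begin with [b] or with a diamond, gives
    [a ^ (n - d) = D + a * #(occurrences of b)], so [a] divides [D] when
    [d < n]; cancelling [a] in [n * D = d * a ^ (n - d)] is the claim. *)

Require Import Defs.
From mathcomp Require Import all_boot.

(** Tuples correspond bijectively to finite functions, for which [card_family] gives the product. *)
Lemma card_tuple_family (A : finType) (n : nat) (F : 'I_n -> pred A) :
  #|[pred y : n.-tuple A | [forall i, F i (tnth y i)]]| = \prod_(i < n) #|F i|.
Proof.
transitivity #|(family F : simpl_pred {ffun 'I_n -> A})|; last first.
  by rewrite card_family foldrE big_map big_enum.
pose f (g : {ffun 'I_n -> A}) := [tuple g i | i < n].
pose h (y : n.-tuple A) := [ffun i => tnth y i].
have fK : cancel f h by move=> g; apply/ffunP => i; rewrite ffunE tnth_mktuple.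
rewrite -(card_image (can_inj fK)); apply: eq_card => y; rewrite inE.
have hK : f (h y) = y.
  by apply: eq_from_tnth => i; rewrite tnth_mktuple ffunE.
rewrite -{2}hK mem_image; last exact: can_inj fK.
by apply: eq_forallb => i; rewrite ffunE.
Qed.

Lemma count_mem_tnth (T : eqType) (n : nat) (t : n.-tuple T) (c : T) :
  count_mem c t = \sum_(i < n) (tnth t i == c).
Proof.
rewrite -sum1_count big_tuple big_mkcond /=.
by apply: eq_bigr => i _; case: eqP.
Qed.

(** Covering is a condition on each letter separately, so the words covered by [x] form a product of
    these sets. *)
Definition covered_letters (A : finType) (o : option A) : pred A :=
  fun c => (o == None) || (o == Some c).

Lemma card_covered_letters (A : finType) (o : option A) :
  #|covered_letters A o| = #|A| ^ (o == None).
Proof.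
case: o => [b|] /=; last by apply: eq_card => c; rewrite inE.
by rewrite -[RHS](card1 b); apply: eq_card => c; rewrite !inE /in_mem /= eq_sym.
Qed.

Lemma card_covered_letters_pred1 (A : finType) (o : option A) (b : A) :
  #|[pred c | covered_letters A o c && (c == b)]| =
  (o == None) + (o == Some b).
Proof.
(* The set is the singleton of [b] or empty, according to whether [o] allows [b]. *)
transitivity (covered_letters A o b : nat); last by case: o.
case ob: (covered_letters A o b).
  rewrite -[RHS](card1 b); apply: eq_card => c; rewrite !inE.
  by case: eqP => [->|_]; rewrite ?ob ?andbF.
by apply: eq_card0 => c; rewrite !inE; case: eqP => [->|_]; rewrite ?ob ?andbF.
Qed.

Lemma card_covers (A : finType) (n : nat) (x : partial_word A n) :
  #|[pred y | covers x y]| = #|A| ^ diamonds x.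
Proof.
rewrite (card_tuple_family A n (fun i => covered_letters A (tnth x i))).
rewrite /diamonds count_mem_tnth expn_sum.
by apply: eq_bigr => i _; rewrite card_covered_letters.
Qed.

(* Multiplying by [#|A|] avoids the exponent [diamonds x - 1]. *)
Lemma card_covers_head (A : finType) (n : nat) (x : partial_word A n.+1)
    (b : A) :
  #|A| * #|[pred y | (tnth y ord0 == b) && covers x y]| =
  ((tnth x ord0 == None) + (tnth x ord0 == Some b) * #|A|) * #|A| ^ diamonds x.
Proof.
rewrite -card_covers.
rewrite (card_tuple_family A _ (fun i => covered_letters A (tnth x i))).
(* Fixing the first letter constrains position 0 only, so the words still form a product. *)
pose F i c := covered_letters A (tnth x i) c && ((i == ord0) ==> (c == b)).
transitivity (#|A| * \prod_(i < n.+1) #|F i|).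
  congr (_ * _); rewrite -card_tuple_family; apply: eq_card => y.
  rewrite !inE; apply/andP/forallP => [[yb /forallP xy] i|Fy].
    by apply/andP; split; [exact: xy | apply/implyP => /eqP ->].
  split; first by have /andP[_] := Fy ord0.
  by apply/forallP => i; have /andP[] := Fy i.
rewrite !big_ord_recl !mulnA; congr (_ * _); last first.
  by apply: eq_bigr => i _; apply: eq_card => c; rewrite /in_mem /= /F andbT.
rewrite card_covered_letters mulnC.
have -> : #|F ord0| = (tnth x ord0 == None) + (tnth x ord0 == Some b).
  rewrite -card_covered_letters_pred1; apply: eq_card => c.
  by rewrite !inE.
by case: (tnth x ord0) => [c|]; rewrite /= ?muln1 ?add0n ?addn0 ?mul0n.
Qed.

(** After exchanging the sums, each word of [P] contributes 1, from the unique position covering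
    it. *)
Lemma upcycle_double_count (A : finType) (n N : nat) (u : partial_word A N)
    (P : pred (n.-tuple A)) :
  upcycle n u ->
  \sum_(i < N) #|[pred y | P y && covers (window u n i) y]| = #|P|.
Proof.
move=> hu; under eq_bigr do rewrite -sum1_card big_mkcondr /=.
rewrite exchange_big /= -sum1_card; apply: eq_bigr => y _.
have [i [iy uniq_i]] := hu y.
rewrite -big_mkcond /= (big_pred1 i) // => j /=.
by apply/idP/eqP => [/uniq_i //|->].
Qed.

(** Rotation by [j] permutes the positions modulo [N]. *)
Lemma sum_shift_mod (N j : nat) (F : nat -> nat) :
  \sum_(i < N) F ((i + j) %% N) = \sum_(i < N) F i.
Proof.
case: N => [|N]; first by rewrite !big_ord0.
pose h (i : 'I_N.+1) := Ordinal (ltn_pmod (i + j) (ltn0Sn N)).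
have h_inj : injective h.
  move=> i k /(congr1 val) /eqP /=; rewrite eqn_modDr !modn_small ?ltn_ord //.
  by move/eqP/val_inj.
by rewrite [RHS](reindex_inj h_inj).
Qed.

(** For each of the [n] offsets in a window, the position read runs once through the cyclic word. *)
Lemma sum_diamonds_window (A : finType) (n N : nat) (u : partial_word A N) :
  \sum_(i < N) diamonds (window u n i) = n * diamonds u.
Proof.
transitivity (\sum_(i < N) \sum_(j < n) (nth None u ((i + j) %% N) == None)).
  apply: eq_bigr => i _; rewrite /diamonds count_mem_tnth.
  by apply: eq_bigr => j _; rewrite tnth_mktuple.
rewrite exchange_big /= /diamonds count_mem_tnth.
under eq_bigr do rewrite (sum_shift_mod _ _ (fun k => nth None u k == None)).
rewrite sum_nat_const card_ord; congr (_ * _); apply: eq_bigr => i _.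
by rewrite (tnth_nth None).
Qed.

Section UpcycleCounts.

Context {A : finType} {n N d : nat} {u : partial_word A N}.
Hypotheses (A_gt0 : 0 < #|A|) (hu : upcycle n u) (hd : has_diamondicity n u d).

Lemma upcycle_length_mul : N * #|A| ^ d = #|A| ^ n.
Proof.
rewrite -[RHS]card_tuple -[RHS](upcycle_double_count _ _ _ _ predT hu).
under eq_bigr => i _ do rewrite (card_covers _ _ (window u n i)) hd.
by rewrite sum_nat_const card_ord.
Qed.

Lemma upcycle_diamondicity_le : d <= n.
Proof.
(* [hd] says nothing when [N = 0]; the position covering some word provides a window. *)
have [y _] : exists y : n.-tuple A, y \in predT.
  by apply/card_gt0P; rewrite card_tuple expn_gt0 A_gt0.
have [i _] := hu y.
by rewrite -(hd i) -[leqRHS](size_tuple (window u n i)) count_size.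
Qed.

Lemma upcycle_length : N = #|A| ^ (n - d).
Proof.
apply/eqP; rewrite -(eqn_pmul2r (m := #|A| ^ d)) ?expn_gt0 ?A_gt0 //.
by rewrite upcycle_length_mul -expnD subnK ?upcycle_diamondicity_le.
Qed.

Lemma upcycle_diamonds : n * diamonds u = N * d.
Proof.
rewrite -sum_diamonds_window; under eq_bigr do rewrite hd.
by rewrite sum_nat_const card_ord.
Qed.

End UpcycleCounts.

Lemma upcycle_letter_count (A : finType) (n N d : nat) (u : partial_word A N)
    (b : A) :
  0 < n -> upcycle n u -> has_diamondicity n u d ->
  N = diamonds u + count_mem (Some b) u * #|A|.
Proof.
case: n => // n _ hu hd.
have A_gt0 : 0 < #|A| by apply/card_gt0P; exists b.
(* Scaled by [#|A| ^ d], both sides equal [#|A|] times the number of words that begin with [b]. *)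
apply/eqP; rewrite -(eqn_pmul2r (m := #|A| ^ d)) ?expn_gt0 ?A_gt0 //; apply/eqP.
have head_count :
    #|A| * #|[pred y : n.+1.-tuple A | tnth y ord0 == b]| = #|A| ^ n.+1.
  pose F (i : 'I_n.+1) : pred A := if i == ord0 then pred1 b else predT.
  rewrite (eq_card (B := [pred y : n.+1.-tuple A |
      [forall i, F i (tnth y i)]])).
    rewrite card_tuple_family big_ord_recl /F /= card1 mul1n.
    by rewrite prod_nat_const card_ord expnS.
  move=> y; rewrite !inE; apply/idP/forallP => [yb i|/(_ ord0) //].
  by rewrite /F; case: eqP => // ->.
rewrite (upcycle_length_mul hu hd) -head_count.
rewrite -(upcycle_double_count _ _ _ _ _ hu) big_distrr /=.
under eq_bigr => i _ do
  rewrite (card_covers_head _ _ (window u n.+1 i)) hd tnth_mktuple addn0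
          modn_small ?ltn_ord // -tnth_nth.
by rewrite -big_distrl big_split -big_distrl /= /diamonds !count_mem_tnth.
Qed.

Theorem corollary7p9 (A : finType) (n N d : nat) (u : partial_word A N)
    (hA : 2 <= #|A|) (hn : 1 <= n)
    (hu : upcycle n u) (hd : has_diamondicity n u d) :
  (n %| d * #|A| ^ (n - d - 1)) /\
  (gcdn d n = 1 -> n %| #|A| ^ (n - d - 1)).
Proof.
have A_gt0 : 0 < #|A| := ltnW hA.
have n_dvd : n %| d * #|A| ^ (n - d - 1).
  have := upcycle_diamondicity_le A_gt0 hu hd.
  (* If [d = n], the factor [d] suffices; otherwise [N], a positive power of [#|A|], is a multiple
     of [#|A|]. *)
  rewrite leq_eqVlt => /predU1P[->|lt_dn]; first exact: dvdn_mulr.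
  have [b _] := card_gt0P A_gt0.
  have N_eq : N = #|A| * #|A| ^ (n - d - 1).
    by rewrite (upcycle_length A_gt0 hu hd) -expnS subn1 prednK ?subn_gt0.
  have /dvdnP[m Dm] : #|A| %| diamonds u.
    rewrite -(dvdn_addl (n := count_mem (Some b) u * #|A|)) ?dvdn_mull //.
    by rewrite -(upcycle_letter_count _ _ _ _ _ b hn hu hd) N_eq dvdn_mulr.
  (* The quotient [m] is [diamonds u] divided by [#|A|]. *)
  apply/dvdnP; exists m; apply/eqP; rewrite -(eqn_pmul2l A_gt0).
  by rewrite mulnCA -N_eq mulnC -(upcycle_diamonds hd) Dm mulnA
             [n * m]mulnC mulnC.
split=> // gcd_dn; rewrite -(Gauss_dvdr _ (m := n) (n := d)) //.
by rewrite /coprime gcdnC gcd_dn.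
Qed.
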